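(* Let $I$ be a nonempty symmetrical subset of $\{1,\dots,p-1\}$, and let $V$ be a restricted $\mathfrak h_I$-module of generic level $\underline l=(l_j)_{j\in I}\in\mathbb C^{|I|}$. Then there exists a restricted $\mathfrak g$-module structure on $V$ given by $$I_n^{(i)}\mapsto\begin{cases}I_n^{(i)}&\text{if }i\in I,\\0&\text{if }i\notin I,\end{cases}\qquad C_i\mapsto\begin{cases}l_i&\text{if }i\in I,\\0&\text{if }i\notin I,\end{cases}\qquad C_0\mapsto|I|,$$ $$L_n\mapsto\sum_{j\in I}\frac1{2l_j}\Bigl(\sum_{k\in\mathbb Z}:I_k^{(j)}I_{n-k-1}^{(p-j)}:\Bigr)+\delta_{n,0}\sum_{j\in I}\frac{j(p-j)}{4p^2},$$ for $n\in\mathbb Z$, $1\le i\le p-1$, where the normal ordered product is $:I_k^{(i)}I_l^{(p-i)}:\,=I_k^{(i)}I_l^{(p-i)}$ if $k<l$ and $:I_k^{(i)}I_l^{(p-i)}:\,=I_l^{(p-i)}I_k^{(i)}$ if $k\ge l$.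
   Context: All vector spaces and algebras are over $\mathbb C$; $p>1$ is a fixed integer. Gap-$p$ Virasoro algebra. $\mathfrak g$ is the Lie algebra with basis $\{L_n, I_n^{(i)}, C_j : n\in\mathbb Z, 1\le i\le p-1, 0\le j\le \lfloor p/2\rfloor\}$ and brackets $[L_m,L_n]=(m-n)L_{m+n}+\frac1{12}(m^3-m)\delta_{m+n,0}C_0$, $[I_m^{(i)},I_n^{(j)}]=(m+\frac ip)\delta_{i+j,p}\delta_{m+n+1,0}C_i$, $[L_m,I_n^{(i)}]=-(n+\frac ip)I_{m+n}^{(i)}$, all $C_k$ central; one sets $C_i:=C_{p-i}$ for $\lfloor p/2\rfloor<i\le p-1$. A subset $I\subseteq\{1,\dots,p-1\}$ is symmetrical if $i\in I$ implies $p-i\in I$. $\mathfrak h_I=\mathrm{Span}\{I_n^{(i)},C_i: n\in\mathbb Z,i\in I\}\subseteq\mathfrak g$. $\mathfrak g$ and $\mathfrak h_I$ are $\mathbb Z$-graded with $L_n,I_n^{(i)}$ in degree $n$ and all $C_j$ in degree $0$. A module $V$ over a $\mathbb Z$-graded Lie algebra $\mathcal L=\oplus_m\mathcal L_m$ is restricted if for each $v\in V$ there is $N\in\mathbb N$, which may be taken positive, with $\mathcal L_nv=0$ for all $n\ge N$. An $\mathfrak h_I$-module has level $\underline l=(l_i)_{i\in I}$ (necessarily with $l_{p-i}=l_i$) if $C_i$ acts as the scalar $l_i$ for every $i\in I$; the level is generic if $l_i\ne0$ for all $i\in I$. *)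

(* Defs.v *)
From HB Require Import structures.
From mathcomp Require Import all_boot all_order all_algebra.
From mathcomp Require Import finmap.
From mathcomp Require Import complex.
From mathcomp Require Import ring lra zify.
From mathcomp.multinomials Require Import monalg.
From mathcomp Require Import boolp classical_sets functions cardinality fsbigop.
From mathcomp Require Import reals.

Set Implicit Arguments.
Unset Strict Implicit.
Unset Printing Implicit Defensive.

Import Order.TTheory GRing.Theory Num.Theory.
Local Open Scope ring_scope.
Local Open Scope complex_scope.

HB.mixin Record Lmodule_isLieAlgebra (K : fieldType) L
    & GRing.Lmodule K L := {
  lie : L -> L -> L;
  lie_linearl : forall y, linear (fun x => lie x y);
  lie_linearr : forall x, linear (lie x);
  liexx : forall x, lie x x = 0;
  lie_jacobi : forall x y z,
    lie x (lie y z) + lie y (lie z x) + lie z (lie x y) = 0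
}.

#[short(type="lieAlgType")]
HB.structure Definition LieAlgebra (K : fieldType) :=
  { L of GRing.Lmodule K L & Lmodule_isLieAlgebra K L }.

Record lieModule (K : fieldType) (L : lieAlgType K) (V : lmodType K) :=
  LieModule {
    lact :> L -> V -> V;
    lact_linearl : forall v, linear (fun x => lact x v);
    lact_linearr : forall x, linear (lact x);
    lact_lie : forall x y v,
      lact (lie x y) v = lact x (lact y v) - lact y (lact x v)
  }.

(** [hom n x] means that [x] belongs to the subspace of degree [n]. *)
Definition restricted (K : fieldType) (L : lieAlgType K) (hom : int -> L -> Prop)
    (V : lmodType K) (rho : lieModule L V) : Prop :=
  forall v : V, exists2 N : nat, (0 < N)%N &
    forall n : int, N%:Z <= n -> forall x : L, hom n x -> rho x v = 0.

Section LinearExtension.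
Context (K : fieldType) (B : choiceType).

Definition malg_lin (W : lmodType K) (f : B -> W) (x : {malg K[B]}) : W :=
  \sum_(b <- msupp x) x@_b *: f b.

Lemma malg_linEw (W : lmodType K) (f : B -> W) (d : {fset B}) x :
  (msupp x `<=` d)%fset -> malg_lin f x = \sum_(b <- d) x@_b *: f b.
Proof.
move=> le; rewrite /malg_lin (big_fset_incl _ le) //= => b _.
by move/mcoeff_outdom => ->; rewrite scale0r.
Qed.

Lemma malg_linP (W : lmodType K) (f : B -> W) : linear (malg_lin f).
Proof.
move=> a x y.
have le : (msupp (a *: x + y) `<=` msupp x `|` msupp y)%fset.
  by apply: (fsubset_trans (msuppD_le _ _)); apply/fsetSU/msuppZ_le.
rewrite (malg_linEw _ le) (malg_linEw _ (fsubsetUl _ (msupp y))).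
rewrite (malg_linEw _ (fsubsetUr (msupp x) _)) scaler_sumr -big_split /=.
apply: eq_bigr => b _.
by rewrite mcoeffD mcoeffZ scalerDl scalerA.
Qed.

Lemma malg_linU (W : lmodType K) (f : B -> W) b : malg_lin f << b >> = f b.
Proof.
rewrite (malg_linEw _ msuppU_le) big_seq_fset1.
by rewrite mcoeffUU scale1r.
Qed.

Lemma malg_scaleU a b : a *: << b >> = << a *g b >> :> {malg K[B]}.
Proof. by apply/malgP => k; rewrite mcoeffZ !mcoeffU mulrnAr mulr1. Qed.

Lemma malg_ind (P : {malg K[B]} -> Prop) :
  P 0 -> (forall a b x, P x -> P (a *: << b >> + x)) -> forall x, P x.
Proof.
move=> P0 PS x; rewrite [x]monalgE.
elim: (enum_fset _) => [|b s IH]; first by rewrite big_nil.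
by rewrite big_cons -malg_scaleU; exact: PS.
Qed.

Definition malg_lie (br : B -> B -> {malg K[B]}) (x y : {malg K[B]}) :=
  malg_lin (fun b => malg_lin (br b) y) x.

Context (br : B -> B -> {malg K[B]}).

Lemma malg_lieE x y : malg_lie br x y =
  \sum_(b <- msupp x) \sum_(c <- msupp y) (x@_b * y@_c) *: br b c.
Proof.
apply: eq_bigr => b _; rewrite scaler_sumr; apply: eq_bigr => c _.
by rewrite scalerA.
Qed.

Lemma malg_lieUU b c : malg_lie br << b >> << c >> = br b c.
Proof. by rewrite /malg_lie !malg_linU. Qed.

Lemma malg_lie_linearl y : linear (fun x => malg_lie br x y).
Proof. exact: malg_linP. Qed.

Lemma malg_lie_linearr x : linear (malg_lie br x).
Proof.
have E t : malg_lie br x t = \sum_(b <- msupp x) x@_b *: malg_lin (br b) t.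
  by [].
move=> a y z; rewrite !E scaler_sumr -big_split /=.
apply: eq_bigr => b _; rewrite (malg_linP (br b) a y z) scalerDr !scalerA.
by rewrite mulrC.
Qed.

Let lieDl a x y z :
  malg_lie br (a *: x + y) z = a *: malg_lie br x z + malg_lie br y z.
Proof. exact: malg_lie_linearl. Qed.

Let lieDr a x y z :
  malg_lie br z (a *: x + y) = a *: malg_lie br z x + malg_lie br z y.
Proof. exact: malg_lie_linearr. Qed.

Lemma malg_lie0r x : malg_lie br x 0 = 0.
Proof. by have := lieDr (-1) 0 0 x; rewrite scaleN1r addNr scaleN1r addNr. Qed.

Lemma malg_lie0l x : malg_lie br 0 x = 0.
Proof. by have := lieDl (-1) 0 0 x; rewrite scaleN1r addNr scaleN1r addNr. Qed.

Lemma malg_lieDl x y z :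
  malg_lie br (x + y) z = malg_lie br x z + malg_lie br y z.
Proof. by have := lieDl 1 x y z; rewrite !scale1r. Qed.

Lemma malg_lieDr x y z :
  malg_lie br z (x + y) = malg_lie br z x + malg_lie br z y.
Proof. by have := lieDr 1 x y z; rewrite !scale1r. Qed.

Lemma malg_lieZl a x z : malg_lie br (a *: x) z = a *: malg_lie br x z.
Proof. by have := lieDl a x 0 z; rewrite addr0 malg_lie0l addr0. Qed.

Lemma malg_lieZr a x z : malg_lie br z (a *: x) = a *: malg_lie br z x.
Proof. by have := lieDr a x 0 z; rewrite addr0 malg_lie0r addr0. Qed.

Let scale_sum3 (W : lmodType K) (a : K) (u u' v v' w w' : W) :
  (a *: u + u') + (a *: v + v') + (a *: w + w')
  = a *: (u + v + w) + (u' + v' + w').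
Proof. by rewrite [X in X + _ = _]addrACA [LHS]addrACA -!scalerDr. Qed.

Let addr_rot (W : zmodType) (u v w : W) : u + v + w = v + w + u.
Proof. by rewrite -addrA addrC. Qed.

Lemma malg_lin_eq0 (W : lmodType K) (f : {malg K[B]} -> W) :
  linear f -> (forall b, f << b >> = 0) -> forall x, f x = 0.
Proof.
move=> fl fU; elim/malg_ind => [|a b x IH]; last by rewrite fl fU IH scaler0 addr0.
by have := fl (-1) 0 0; rewrite !scaleN1r !addNr.
Qed.

Lemma malg_lieC :
  (forall b c, br b c = - br c b) ->
  forall x y, malg_lie br x y = - malg_lie br y x.
Proof.
move=> H x y; apply/eqP; rewrite -addr_eq0; apply/eqP.
pose S x y := malg_lie br x y + malg_lie br y x; rewrite -/(S x y).
have Sl z : linear (S^~ z).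
  by move=> a t u; rewrite /S lieDl lieDr addrACA -scalerDr.
have SC t u : S t u = S u t by exact: addrC.
apply: (malg_lin_eq0 (Sl y)) => b; rewrite SC.
apply: (malg_lin_eq0 (Sl << b >>)) => c.
by rewrite /S !malg_lieUU H addNr.
Qed.

Lemma malg_liexx :
  (forall b, br b b = 0) -> (forall b c, br b c = - br c b) ->
  forall x, malg_lie br x x = 0.
Proof.
move=> H1 H; elim/malg_ind => [|a b x IHx]; first by rewrite malg_lie0l.
rewrite lieDl lieDr malg_lieDr IHx malg_lieUU H1 scaler0 add0r addr0.
by rewrite malg_lieZr [X in _ *: X + _]malg_lieC // scalerN addNr.
Qed.

Lemma malg_lie_jacobi :
  (forall b c d, malg_lie br << b >> (br c d) + malg_lie br << c >> (br d b)
      + malg_lie br << d >> (br b c) = 0) ->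
  forall x y z, malg_lie br x (malg_lie br y z) + malg_lie br y (malg_lie br z x)
    + malg_lie br z (malg_lie br x y) = 0.
Proof.
move=> H x y z.
pose J x y z := malg_lie br x (malg_lie br y z)
  + malg_lie br y (malg_lie br z x) + malg_lie br z (malg_lie br x y).
rewrite -/(J x y z).
have Jl t u : linear (fun s => J s t u).
  move=> a s s'; rewrite /J lieDl (lieDr a s s' u) (lieDl a s s' t) !lieDr.
  exact: scale_sum3.
have rot s t u : J s t u = J t u s by exact: addr_rot.
apply: (malg_lin_eq0 (Jl y z)) => b; rewrite rot.
apply: (malg_lin_eq0 (Jl z << b >>)) => c; rewrite rot.
apply: (malg_lin_eq0 (Jl << b >> << c >>)) => d; rewrite rot.
by rewrite /J !malg_lieUU.
Qed.

End LinearExtension.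

(** The integers [1 <= i <= p-1]. *)
Definition gap_index (p : nat) : Type := {i : 'I_p | (0 < i)%N}.
HB.instance Definition _ p := Finite.on (gap_index p).

Definition gap_val p (i : gap_index p) : nat := val (val i).
Coercion gap_val : gap_index >-> nat.

Lemma gap_opp_subproof1 p (i : gap_index p) : (p - i < p)%N.
Proof. by have := valP i; have := ltn_ord (val i); rewrite /gap_val /=; lia. Qed.

Lemma gap_opp_subproof2 p (i : gap_index p) :
  (0 < Ordinal (gap_opp_subproof1 i))%N.
Proof. by have := ltn_ord (val i); rewrite /gap_val /=; lia. Qed.

Definition gap_opp p (i : gap_index p) : gap_index p :=
  exist _ (Ordinal (gap_opp_subproof1 i)) (gap_opp_subproof2 i).

Definition symmetrical p (I : {set gap_index p}) : Prop :=
  forall i, i \in I -> gap_opp i \in I.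

Lemma gap_cen_subproof p (i : gap_index p) :
  ((if (i <= p./2)%N then (i : nat) else (p - i)%N) < (p./2).+1)%N.
Proof. by case: ifP; lia. Qed.

(** The index of the central element called [C_i]: it is [C_(p-i)] when
    [p./2 < i]. *)
Definition gap_cen p (i : gap_index p) : 'I_(p./2).+1 :=
  Ordinal (gap_cen_subproof i).

Inductive gap_basis (p : nat) : Type :=
| GapL of int
| GapI of int & gap_index p
| GapC of 'I_(p./2).+1.
Arguments GapL {p}.
Arguments GapI {p}.
Arguments GapC {p}.

Definition gap_basis_code p (b : gap_basis p) :
    int + (int * gap_index p) + 'I_(p./2).+1 :=
  match b with
  | GapL n => inl (inl n)
  | GapI n i => inl (inr (n, i))
  | GapC k => inr k
  end.

Definition gap_basis_decode p (c : int + (int * gap_index p) + 'I_(p./2).+1) :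
    gap_basis p :=
  match c with
  | inl (inl n) => GapL n
  | inl (inr (n, i)) => GapI n i
  | inr k => GapC k
  end.

Lemma gap_basis_codeK p : cancel (@gap_basis_code p) (@gap_basis_decode p).
Proof. by case. Qed.

HB.instance Definition _ p := Choice.copy (gap_basis p)
  (can_type (@gap_basis_codeK p)).

(** The bracket of two basis elements, [e] being the basis. *)
Definition gap_br (K : numFieldType) (p : nat) (W : lmodType K)
    (e : gap_basis p -> W) (b c : gap_basis p) : W :=
  match b, c with
  | GapL m, GapL n =>
      (m - n)%:~R *: e (GapL (m + n))
      + ((m ^+ 3 - m)%:~R / 12 * (m + n == 0)%:R) *: e (GapC ord0)
  | GapI m i, GapI n j =>
      ((m%:~R + i%:R / p%:R) * ((i + j == p)%N && (m + n + 1 == 0))%:R)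
        *: e (GapC (gap_cen i))
  | GapL m, GapI n i => - (n%:~R + i%:R / p%:R) *: e (GapI (m + n) i)
  | GapI n i, GapL m => (n%:~R + i%:R / p%:R) *: e (GapI (m + n) i)
  | GapC _, _ | _, GapC _ => 0
  end.

Lemma gap_opp_val p (i : gap_index p) : gap_opp i = (p - i)%N :> nat.
Proof. by []. Qed.

Lemma gap_index_bounds p (i : gap_index p) : (0 < i < p)%N.
Proof. by rewrite (valP i) /=; exact: ltn_ord (val i). Qed.

Lemma gap_cen_sym p (i j : gap_index p) : (i + j = p)%N ->
  gap_cen i = gap_cen j.
Proof.
move=> e; apply/val_inj => /=; have := gap_index_bounds i.
by do 2! case: ifP; lia.
Qed.

Section GapLie.
Context (K : numFieldType) (p : nat) (W : lmodType K) (e : gap_basis p -> W).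
Implicit Types b c d : gap_basis p.
Local Notation br := (gap_br e).

Let pfrac (i j : gap_index p) : (i + j = p)%N ->
  (i%:R / p%:R : K) = 1 - j%:R / p%:R.
Proof.
move=> h; have p0 : (p%:R : K) != 0.
  by rewrite pnatr_eq0; have := gap_index_bounds i; lia.
by apply/eqP; rewrite eq_sym subr_eq -mulrDl -natrD h divff.
Qed.

Lemma gap_brC b c : br b c = - br c b.
Proof.
case: b => [m|m i|k]; case: c => [n|n j|k'] /=; rewrite ?oppr0 //.
- rewrite opprD -2!scaleNr (addrC n m) !rmorphB /= opprB; congr (_ + _ *: _).
  case: eqP => [h|_]; last by rewrite !mulr0 oppr0.
  have -> : n = - m by lia.
  by rewrite !mulr1 !(rmorphB, rmorphN, rmorphXn) /=; ring.
- by rewrite scaleNr.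
- by rewrite scaleNr opprK.
- rewrite (addnC j i) (addrC n m).
  case: (boolP ((i + j == p)%N && _)) => [/andP[/eqP h /eqP h']|_]; last first.
    by rewrite !mulr0 !scale0r oppr0.
  rewrite (gap_cen_sym h) (pfrac h) !mulr1 -scaleNr; congr (_ *: _).
  have -> : n = - m - 1 by lia.
  by rewrite !(rmorphB, rmorphN) /=; ring.
Qed.

Lemma gap_brxx b : br b b = 0.
Proof.
have /eqP : br b b + br b b = 0 by rewrite {1}gap_brC addNr.
by rewrite -mulr2n -scaler_nat scaler_eq0 pnatr_eq0 => /eqP.
Qed.

Context (ad : gap_basis p -> {linear W -> W}).
Hypothesis adE : forall b c, ad b (e c) = br b c.

Let J b c d := ad b (br c d) + ad c (br d b) + ad d (br b c).

Let Jrot b c d : J b c d = J c d b.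
Proof. by rewrite /J -addrA addrC. Qed.

Let sc0 (a : K) (v : W) : a = 0 -> a *: v = 0.
Proof. by move->; rewrite scale0r. Qed.

Let J_LLL m n k : J (GapL m) (GapL n) (GapL k) = 0.
Proof.
rewrite /J /= !(linearD, linearZ) /= !adE /= !scaler0 !addr0 !scalerDr !scalerA.
have -> : m + (n + k) = m + n + k by ring.
have -> : n + (k + m) = m + n + k by ring.
have -> : k + (m + n) = m + n + k by ring.
rewrite [X in X + _ = _]addrACA [LHS]addrACA -!scalerDl.
rewrite !sc0 ?addr0 //; first last.
  by rewrite !(rmorphB, rmorphD) /=; ring.
case: eqP => [h|_]; last by rewrite !mulr0 !addr0.
have -> : k = - m - n by lia.
by rewrite !(rmorphB, rmorphD, rmorphN, rmorphXn) /=; ring.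
Qed.

Let J_LLI m n k i : J (GapL m) (GapL n) (GapI k i) = 0.
Proof.
rewrite /J /= !(linearD, linearZ) /= !adE /= !scaler0 !addr0 !scalerA.
have -> : m + (n + k) = m + n + k by ring.
have -> : n + (m + k) = m + n + k by ring.
by rewrite -!scalerDl; apply: sc0; rewrite !(rmorphB, rmorphD) /=; ring.
Qed.

Let J_LII m n i k j : J (GapL m) (GapI n i) (GapI k j) = 0.
Proof.
rewrite /J /= !linearZ /= !adE /= scaler0 add0r !scalerA.
have -> : n + (m + k) = m + n + k by ring.
have -> : k + (m + n) = m + n + k by ring.
rewrite (addnC j i).
case: (boolP ((i + j == p)%N && _)) => [/andP[/eqP h /eqP h']|_].
  rewrite (gap_cen_sym h) -scalerDl; apply: sc0.
  by rewrite (pfrac h) (_ : k = - 1 - m - n); last lia;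
     rewrite !(rmorphB, rmorphD, rmorphN) /=; ring.
by rewrite !mulr0 !scale0r addr0.
Qed.

Let J_III m h n i k j : J (GapI m h) (GapI n i) (GapI k j) = 0.
Proof. by rewrite /J /= !linearZ /= !adE /= !scaler0 !addr0. Qed.

Hypothesis adC : forall k w, ad (GapC k) w = 0.

Let J_C k b c : J (GapC k) b c = 0.
Proof.
have brC d : br d (GapC k) = 0 by case: d.
by rewrite /J adC brC /= !linear0 !addr0.
Qed.

Lemma gap_br_jacobi b c d :
  ad b (br c d) + ad c (br d b) + ad d (br b c) = 0.
Proof.
rewrite -/(J b c d).
case: b => [m|m h|k'']; last exact: J_C.
all: case: c => [n|n i|k'']; last by rewrite Jrot; exact: J_C.
all: case: d => [k|k j|k'']; last by rewrite -Jrot; exact: J_C.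
- exact: J_LLL.
- exact: J_LLI.
- by rewrite -Jrot; exact: J_LLI.
- exact: J_LII.
- by rewrite Jrot; exact: J_LLI.
- by rewrite Jrot; exact: J_LII.
- by rewrite -Jrot; exact: J_LII.
- exact: J_III.
Qed.

End GapLie.

Definition gapVir (K : numFieldType) (p : nat) : Type := {malg K[gap_basis p]}.
HB.instance Definition _ K p := GRing.Lmodule.on (gapVir K p).

Definition gapL {K : numFieldType} {p : nat} (n : int) : gapVir K p :=
  << GapL n >>.
Definition gapI {K : numFieldType} {p : nat} (n : int) (i : gap_index p) :
  gapVir K p := << GapI n i >>.
Definition gapC {K : numFieldType} {p : nat} (k : 'I_(p./2).+1) : gapVir K p :=
  << GapC k >>.

Section GapVirLie.
Context (K : numFieldType) (p : nat).

Definition gap_lie : gapVir K p -> gapVir K p -> gapVir K p :=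
  malg_lie (gap_br (fun b => << b >>)).

Lemma gap_lieUU b c :
  gap_lie << b >> << c >> = gap_br (fun b => << b >> : gapVir K p) b c.
Proof. exact: malg_lieUU. Qed.

Lemma gap_lie_linearl y : linear (fun x => gap_lie x y).
Proof. exact: malg_lie_linearl. Qed.

Lemma gap_lie_linearr x : linear (gap_lie x).
Proof. exact: malg_lie_linearr. Qed.

Lemma gap_liexx x : gap_lie x x = 0.
Proof. by apply: malg_liexx => *; [exact: gap_brxx | exact: gap_brC]. Qed.

HB.instance Definition _ x := GRing.isLinear.Build K (gapVir K p) (gapVir K p)
  _ (gap_lie x) (gap_lie_linearr x).

Lemma gap_lie_jacobi x y z :
  gap_lie x (gap_lie y z) + gap_lie y (gap_lie z x) + gap_lie z (gap_lie x y)
  = 0.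
Proof.
apply: malg_lie_jacobi => b c d.
apply: (gap_br_jacobi (ad := fun b : gap_basis p => gap_lie << b >>)).
  exact: gap_lieUU.
move=> k; apply: (malg_lin_eq0 (@gap_lie_linearr _)) => b'; exact: gap_lieUU.
Qed.

HB.instance Definition _ := Lmodule_isLieAlgebra.Build K (gapVir K p)
  gap_lie_linearl gap_lie_linearr gap_liexx gap_lie_jacobi.

End GapVirLie.

Definition gap_deg p (b : gap_basis p) : int :=
  match b with GapL n => n | GapI n _ => n | GapC _ => 0 end.

(** The span of the basis elements that satisfy [P]. *)
Definition gap_span (K : numFieldType) p (P : pred (gap_basis p)) :
    {pred gapVir K p} :=
  fun x => all P (msupp x).

Lemma gap_span_submod_closed (K : numFieldType) p (P : pred (gap_basis p)) :
  submod_closed (@gap_span K p P).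
Proof.
split=> [|a x y /allP Px /allP Py]; first by rewrite /in_mem /= /gap_span msupp0.
apply/allP => b /(fsubsetP (msuppD_le _ _)) /fsetUP[|/Py //].
by move=> /(fsubsetP (msuppZ_le _ _)) /Px.
Qed.

HB.instance Definition _ (K : numFieldType) p (P : pred (gap_basis p)) :=
  GRing.isSubmodClosed.Build K (gapVir K p) (gap_span P)
    (gap_span_submod_closed K P).

Lemma gap_spanP (K : numFieldType) p (P : pred (gap_basis p)) (x : gapVir K p) :
  reflect (exists2 s : seq (K * gap_basis p), all (fun u => P u.2) s &
             x = \sum_(u <- s) u.1 *: << u.2 >>)
          (x \in gap_span P).
Proof.
apply: (iffP idP) => [/allP Px|[s]].
  exists [seq (x@_b, b) | b <- msupp x].
    by apply/allP => _ /mapP[b bx ->] /=; exact: Px.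
  rewrite big_map {1}[x]monalgE; apply: eq_bigr => b _.
  exact: esym (malg_scaleU _ _).
move=> /allP sP ->; rewrite big_seq; apply: rpred_sum => u /sP Pu.
apply: rpredZ; apply/allP => b /(fsubsetP msuppU_le) /fset1P ->.
exact: Pu.
Qed.

(** A grading of the vector space only: [[I_m^(i), I_n^(j)]] is proportional to
    [C_i], of degree [0], when [m + n = -1]. *)
Definition gap_hom (K : numFieldType) p (n : int) (x : gapVir K p) : Prop :=
  x \in gap_span (fun b => gap_deg b == n).

Definition heis_basis p (I : {set gap_index p}) : pred (gap_basis p) :=
  fun b => match b with
  | GapL _ => false
  | GapI _ i => i \in I
  | GapC k => [exists i in I, k == gap_cen i]
  end.

Record heis (K : numFieldType) p (I : {set gap_index p}) := Heis {
  heis_val :> gapVir K p;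
  heis_valP : heis_val \in gap_span (heis_basis I)
}.

HB.instance Definition _ K p I := [isSub for @heis_val K p I].
HB.instance Definition _ K p I := [Choice of @heis K p I by <:].
HB.instance Definition _ (K : numFieldType) p I :=
  [SubChoice_isSubLmodule of @heis K p I by <:].

Section HeisLie.
Context (K : numFieldType) (p : nat) (I : {set gap_index p}).
Local Notation h := (heis K I).

Lemma heis_lie_closed (x y : h) :
  lie (val x) (val y) \in gap_span (heis_basis I).
Proof.
case: x y => [x /allP Px] [y /allP Py] /=.
rewrite /lie /= /gap_lie malg_lieE.
rewrite big_seq; apply: rpred_sum => b /Px.
case: b => // [m i|k] Pb; last first.
  by apply: rpred_sum => c _; apply: rpredZ; exact: rpred0.
rewrite big_seq; apply: rpred_sum => c /Py Pc; apply: rpredZ.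
case: c Pc => // [n j|k] Pc; last exact: rpred0.
apply: rpredZ; apply/allP => b /(fsubsetP msuppU_le) /fset1P ->.
by apply/existsP; exists i; apply/andP; split.
Qed.

Definition heis_lie (x y : h) : h := Heis (heis_lie_closed x y).

Lemma heis_lie_linearl y : linear (heis_lie^~ y).
Proof. by move=> a x x'; apply/val_inj; exact: lie_linearl. Qed.

Lemma heis_lie_linearr x : linear (heis_lie x).
Proof. by move=> a y y'; apply/val_inj; exact: lie_linearr. Qed.

Lemma heis_liexx x : heis_lie x x = 0.
Proof. by apply/val_inj; exact: liexx. Qed.

Lemma heis_lie_jacobi x y z :
  heis_lie x (heis_lie y z) + heis_lie y (heis_lie z x)
  + heis_lie z (heis_lie x y) = 0.
Proof. by apply/val_inj; exact: lie_jacobi. Qed.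

HB.instance Definition _ := Lmodule_isLieAlgebra.Build K h
  heis_lie_linearl heis_lie_linearr heis_liexx heis_lie_jacobi.

End HeisLie.

Definition heis_hom (K : numFieldType) p (I : {set gap_index p}) (n : int)
  (x : heis K I) : Prop := gap_hom n (val x).

(** [I_n^(i)] and [C_i] as elements of the subalgebra; both are [0], a junk
    value, when [i] is not in [I] (for [heisC], when moreover [p - i] is not
    in [I]). *)
Definition heisI {K : numFieldType} {p} {I : {set gap_index p}}
  (n : int) (i : gap_index p) : heis K I := insubd 0 (gapI n i).

Definition heisC {K : numFieldType} {p} {I : {set gap_index p}}
  (i : gap_index p) : heis K I := insubd 0 (gapC (gap_cen i)).

Lemma val_heisI (K : numFieldType) p (I : {set gap_index p}) n i :
  i \in I -> val (heisI n i : heis K I) = gapI n i.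
Proof.
move=> iI; rewrite insubdK //; apply/allP => b.
by move=> /(fsubsetP msuppU_le) /fset1P ->.
Qed.

Lemma val_heisC (K : numFieldType) p (I : {set gap_index p}) i :
  i \in I -> val (heisC i : heis K I) = gapC (gap_cen i).
Proof.
move=> iI; rewrite insubdK //; apply/allP => b.
move=> /(fsubsetP msuppU_le) /fset1P -> /=.
by apply/existsP; exists i; rewrite iI eqxx.
Qed.

Section Level.
Context (K : numFieldType) (p : nat) (I : {set gap_index p}) (V : lmodType K).
Implicit Types (rho : lieModule (heis K I) V) (l : gap_index p -> K).

(** Only the values of [l] on [I] matter. *)
Definition has_level rho l : Prop :=
  forall i, i \in I -> forall v, rho (heisC i) v = l i *: v.

Definition generic_level l : Prop := forall i, i \in I -> l i != 0.

(** The normally ordered product [:I_k^(i) I_m^(p-i):], for [i] and [p - i]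
    in [I]. *)
Definition normal_ord rho (i : gap_index p) (k m : int) (v : V) : V :=
  if k < m then rho (heisI k i) (rho (heisI m (gap_opp i)) v)
  else rho (heisI m (gap_opp i)) (rho (heisI k i) v).

Definition locally_finite (F : int -> V -> V) : Prop :=
  forall v, finite_set [set k | F k v <> 0]%classic.

(** [\sum_(k \in setT)] is the sum of a finitely supported family; it would be
    [0] if the families were not [locally_finite]. *)
Definition sugawara rho l (n : int) (v : V) : V :=
  \sum_(j in I) (2 * l j)^-1 *:
    (\sum_(k \in [set: int]%classic) normal_ord rho j k (n - k - 1) v)
  + ((n == 0)%:R * \sum_(j in I) (gap_val j * (p - gap_val j))%N%:R / (4 * p%:R ^+ 2)) *: v.

End Level.

(* Main.v *)
Require Import Defs.
From HB Require Import structures.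
From mathcomp Require Import finmap monalg.
From mathcomp Require Import boolp classical_sets cardinality fsbigop.
From mathcomp Require Import all_boot all_order all_algebra.
From mathcomp Require Import complex reals.
From mathcomp Require Import ring zify.
Import Order.TTheory GRing.Theory Num.Theory.
Local Open Scope ring_scope.
Local Open Scope complex_scope.

Set Implicit Arguments.
Unset Strict Implicit.
Unset Printing Implicit Defensive.

(** Write [X_i(n)] for the action of [I_n^(i)], with [i] in [I].  The statement
    is the Sugawara construction for the free bosons [X_i], which are coupled
    in pairs [i], [p - i] by [[X_i(m), X_(p-i)(n)] = (m + i/p) l_i] for
    [m + n = -1].

    Only finitely many normally ordered products act non-trivially on a given
    vector, because in each of them the factor that acts first has large
    index when the summation variable is far from [0]
    ([mode_nord_vanish]); so the operator [L_n] makes sense, and it kills a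
    given vector for large [n].

    The bracket of [L_n] with a mode is computed product by product
    ([mode_quad_comm_mode]): the commutators of modes are scalars, so the
    bracket of a quadratic product with a mode is linear in the modes, and
    does not depend on the order of the product.  The terms [j = i] and
    [j = p - i] of [L_n] contribute one half each (if [i = p - i], a single
    term contributes twice), which gives
    [[L_n, X_i(r)] = - (r + i/p) X_i(n + r)] ([mode_sugawara_comm_mode]).

    This in turn gives the bracket of [L_m] with a product
    [X_j(k) X_(p-j)(n-k-1)].  Summation over [k] and a shift by [m] in one of
    the two resulting sums leave [m - n] times the quadratic sum of degree
    [m + n] ([mode_sugawara_comm_quad]).  If [m + n = 0], with [m > 0] say,
    each product must also be put back in normal order, at the price of a
    scalar; the shift misaligns these scalars, and they cancel except for
    [- m <= k < 0].  With [a = j/p], what remains is a finite sum that equals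
    [(m^3 - m)/6 + m a (1 - a)] times [l_j] ([sum_cocycle]).  After division
    by [2 l_j], the first part gives central charge [1] for each [j], and the
    second one is [2 m] times the summand [j(p-j)/(4p^2)] of the constant in
    [L_0]: this is what that constant is for. *)

(** * Sums of finitely supported families *)

Section FiniteSupportSums.
Context (T : choiceType).

Definition finsupp (W : zmodType) (f : T -> W) : Prop :=
  finite_set [set k | f k <> 0]%classic.

Lemma finsuppP (W : zmodType) (f : T -> W) :
  finsupp f <-> exists A : {fset T}, forall k, k \notin A -> f k = 0.
Proof.
split=> [/finite_fsetP[A fA]|[A fA]].
  exists A => k kA; apply: contrapT => fk.
  have : [set` A]%classic k by rewrite -fA.
  by move=> /= kA'; rewrite kA' in kA.
apply: (sub_finite_set _ (finite_fset A)) => k /= fk.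
by apply/negPn/negP => /fA.
Qed.

Lemma finsuppD (W : zmodType) (f g : T -> W) :
  finsupp f -> finsupp g -> finsupp (fun k => f k + g k).
Proof.
move=> /finsuppP[A fA] /finsuppP[B gB]; apply/finsuppP; exists (A `|` B)%fset.
by move=> k; rewrite in_fsetU negb_or => /andP[kA kB]; rewrite fA // gB // addr0.
Qed.

Lemma finsupp_map (W W' : zmodType) (h : T -> W -> W') (f : T -> W) :
  (forall k, h k 0 = 0) -> finsupp f -> finsupp (fun k => h k (f k)).
Proof.
move=> h0 /finsuppP[A fA]; apply/finsuppP; exists A => k /fA ->; exact: h0.
Qed.

Lemma fsumD (W : zmodType) (f g : T -> W) : finsupp f -> finsupp g ->
  \sum_(k \in [set: T]%classic) (f k + g k)
  = \sum_(k \in [set: T]%classic) f k + \sum_(k \in [set: T]%classic) g k.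
Proof.
move=> /finsuppP[A fA] /finsuppP[B gB].
have fAB k : k \notin (A `|` B)%fset -> f k = 0.
  by rewrite in_fsetU negb_or => /andP[/fA].
have gAB k : k \notin (A `|` B)%fset -> g k = 0.
  by rewrite in_fsetU negb_or => /andP[_ /gB].
rewrite !(fsbigTE (A `|` B)%fset) ?big_split // => k kAB.
by rewrite fAB // gAB // addr0.
Qed.

Lemma fsum_additive (W W' : zmodType) (h : {additive W -> W'}) (f : T -> W) :
  finsupp f ->
  h (\sum_(k \in [set: T]%classic) f k) = \sum_(k \in [set: T]%classic) h (f k).
Proof.
move=> /finsuppP[A fA]; rewrite !(fsbigTE A) ?raddf_sum // => k /fA ->.
exact: raddf0.
Qed.

Lemma fsum1 (W : zmodType) (k0 : T) (f : T -> W) :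
  (forall k, k != k0 -> f k = 0) -> \sum_(k \in [set: T]%classic) f k = f k0.
Proof.
move=> f0; rewrite (fsbigTE [fset k0]%fset) ?big_seq_fset1 // => k.
by rewrite in_fset1; exact: f0.
Qed.

Lemma finsupp1 (W : zmodType) (k0 : T) (f : T -> W) :
  (forall k, k != k0 -> f k = 0) -> finsupp f.
Proof.
move=> f0; apply/finsuppP; exists [fset k0]%fset => k.
by rewrite in_fset1; exact: f0.
Qed.

End FiniteSupportSums.

Lemma finsupp_shift (W : zmodType) (f : int -> W) (m : int) :
  finsupp f -> finsupp (fun k => f (k + m)).
Proof.
move=> /finsuppP[A fA]; apply/finsuppP.
exists [fset (k - m)%R | k in A]%fset => k kA; apply: fA; apply: contra kA => kA.
by apply/imfsetP; exists (k + m) => //; rewrite addrK.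
Qed.

Lemma fsum_shift (W : zmodType) (f : int -> W) (m : int) :
  \sum_(k \in [set: int]%classic) f (k + m) = \sum_(k \in [set: int]%classic) f k.
Proof.
symmetry; apply: (@reindex_fsbigT _ _ _ _ _ (fun k : int => k + m)).
by exists (fun k => k - m) => k; rewrite ?addrK ?subrK.
Qed.

Lemma finsupp_itv (W : zmodType) (f : int -> W) (a b : int) :
  (forall k, k < a \/ b <= k -> f k = 0) -> finsupp f.
Proof.
move=> f0; apply: (sub_finite_set _
  (finite_image (fun i : nat => a + i%:Z) (finite_II `|b - a|%N))) => k /= fk.
have [ka|ka] := ltP k a; first by case: fk; apply: f0; left.
have [bk|bk] := leP b k; first by case: fk; apply: f0; right.
exists `|k - a|%N; rewrite /=; lia.
Qed.

(** The shape in which the central term appears: a family supported on the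
    [t] integers just below [0]. *)
Lemma fsum_neg_window (W : zmodType) (f : int -> W) (t : nat) :
  (forall k, k < - t%:Z \/ 0 <= k -> f k = 0) ->
  \sum_(k \in [set: int]%classic) f k = \sum_(i < t) f (- i.+1%:Z).
Proof.
move=> f0.
have rU : uniq [seq - i.+1%:Z | i <- iota 0 t].
  by rewrite map_inj_uniq ?iota_uniq // => x y; lia.
rewrite (fsbigE _ _ rU) //; last first.
  move=> k _ kt; apply: f0.
  have [//|tk] := ltP k (- t%:Z); first by left.
  have [//|k0] := leP 0 k; first by right.
  case/negP: kt; apply/mapP; exists (`|k|%N).-1; last by lia.
  by rewrite mem_iota; lia.
rewrite big_map; under eq_bigl do rewrite classical_sets.in_setT.
by rewrite -(big_mkord xpredT (fun i => f (- i.+1%:Z))) /index_iota subn0.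
Qed.

(** * Modules and central indices *)

HB.instance Definition _ (K : fieldType) (L : lieAlgType K) (V : lmodType K)
  (rho : lieModule L V) (x : L) :=
  GRing.isLinear.Build K V V _ (lact rho x) (lact_linearr rho x).

Lemma lact0 (K : fieldType) (L : lieAlgType K) (V : lmodType K)
  (rho : lieModule L V) v : rho 0 v = 0.
Proof.
have := lact_linearl rho v (-1) 0 0.
by rewrite scaleN1r oppr0 addr0 scaleN1r addNr.
Qed.

Lemma lactZ (K : fieldType) (L : lieAlgType K) (V : lmodType K)
  (rho : lieModule L V) a x v : rho (a *: x) v = a *: rho x v.
Proof. by have := lact_linearl rho v a x 0; rewrite !addr0 lact0 addr0. Qed.

Lemma gap_oppK p : involutive (@gap_opp p).
Proof.
move=> i; apply/val_inj/val_inj => /=.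
by have /andP[_ ip] := gap_index_bounds i; rewrite subKn // ltnW.
Qed.

Lemma gap_add_eqp p (i j : gap_index p) : (i + j == p)%N = (j == gap_opp i).
Proof.
have /andP[_ ip] := gap_index_bounds i.
apply/eqP/eqP => [h|->]; last by rewrite gap_opp_val subnKC // ltnW.
apply/val_inj/val_inj; rewrite /= -/(gap_val i) -/(gap_val j); lia.
Qed.

Lemma gap_cen_opp p (i : gap_index p) : gap_cen (gap_opp i) = gap_cen i.
Proof.
by symmetry; apply: gap_cen_sym; apply/eqP; rewrite gap_add_eqp.
Qed.

Lemma gap_cen_eq p (i j : gap_index p) :
  gap_cen i = gap_cen j -> j = i \/ j = gap_opp i.
Proof.
move=> /(congr1 val) /=; have := gap_index_bounds i.
have := gap_index_bounds j => hj hi.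
case: ifP => hi'; case: ifP => hj' h;
  [left | right | right | left]; apply/val_inj/val_inj;
  rewrite /= -/(gap_val i) -/(gap_val j); lia.
Qed.

Lemma gap_cen_neq0 p (i : gap_index p) : (gap_cen i == ord0) = false.
Proof.
by apply/eqP => /(congr1 val) /=; have := gap_index_bounds i; case: ifP; lia.
Qed.

Lemma heisI_out (K : numFieldType) p (I : {set gap_index p}) n i :
  i \notin I -> heisI n i = 0 :> heis K I.
Proof.
move=> iI; rewrite /heisI /insubd insubN //; apply: contra iI => /allP/(_ (GapI n i)).
by apply; rewrite msuppU oner_eq0 in_fset1 eqxx.
Qed.

Lemma heisC_opp (K : numFieldType) p (I : {set gap_index p}) i :
  heisC (gap_opp i) = heisC i :> heis K I.
Proof. exact: (congr1 (fun k => insubd 0 (gapC k)) (gap_cen_opp i)). Qed.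

(** * The Sugawara operators of a system of modes *)

(** The operators that represent [I_n^(i)] are taken here as an abstract
    family [X], of which only the commutators and the vanishing for large
    index matter.  The symmetry of the level is assumed on vectors, in
    [level_opp]: on the zero space the scalars [l i] and [l (gap_opp i)] can
    differ. *)
Section Modes.
Context (K : numFieldType) (p : nat) (I : {set gap_index p}) (V : lmodType K).
Context (X : gap_index p -> int -> {linear V -> V}) (l : gap_index p -> K).

Local Notation frac i := ((gap_val i)%:R / p%:R : K).

Definition mode_nord (i : gap_index p) (k m : int) (v : V) : V :=
  if k < m then X i k (X (gap_opp i) m v) else X (gap_opp i) m (X i k v).

Definition mode_quad j n (v : V) : V :=
  \sum_(k \in [set: int]%classic) mode_nord j k (n - k - 1) v.

Definition mode_sugawara n (v : V) : V :=
  \sum_(j in I) (2 * l j)^-1 *: mode_quad j n v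
  + ((n == 0)%:R * \sum_(j in I)
       (gap_val j * (p - gap_val j))%N%:R / (4 * p%:R ^+ 2)) *: v.

Hypotheses (I_sym : symmetrical I) (l_generic : generic_level I l)
  (level_opp : forall i (v : V), i \in I -> l (gap_opp i) *: v = l i *: v)
  (mode_out : forall i n v, i \notin I -> X i n v = 0)
  (mode_comm : forall i j m n (v : V), i \in I -> j \in I ->
    X i m (X j n v) = X j n (X i m v)
    + ((m%:~R + frac i) * ((j == gap_opp i) && (m + n + 1 == 0))%:R)
        *: (l i *: v))
  (mode_vanish : forall v, exists2 N : nat, (0 < N)%N &
    forall i n, N%:Z <= n -> X i n v = 0).

Lemma frac_opp (i : gap_index p) : frac (gap_opp i) = 1 - frac i.
Proof.
have /andP[i0 ip] := gap_index_bounds i.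
have p0 : (p%:R : K) != 0 by rewrite pnatr_eq0; lia.
by rewrite gap_opp_val natrB ?(ltnW ip) // mulrBl divff.
Qed.

Lemma gap_opp_in i : (gap_opp i \in I) = (i \in I).
Proof. by apply/idP/idP => /I_sym //; rewrite gap_oppK. Qed.

Lemma mode_nord_linear i k m : linear (mode_nord i k m).
Proof.
by move=> a u v; rewrite /mode_nord; case: ifP => _; rewrite !linearP.
Qed.
HB.instance Definition _ i k m := GRing.isLinear.Build K V V _
  (mode_nord i k m) (mode_nord_linear i k m).

(** Normal ordering lets the factor of larger index act first, so it is enough
    that one of the two indices, no matter which, is large. *)
Lemma mode_nord_vanish v (N : nat) i k m :
  (forall i n, N%:Z <= n -> X i n v = 0) -> N%:Z <= k \/ N%:Z <= m ->
  mode_nord i k m v = 0.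
Proof.
move=> NP h; rewrite /mode_nord; case: ifP => km.
  by rewrite NP ?linear0 //; lia.
by rewrite NP ?linear0 //; lia.
Qed.

Lemma mode_nord_finsupp n j v :
  finsupp (fun k => mode_nord j k (n - k - 1) v).
Proof.
have [N _ NP] := mode_vanish v.
apply: (finsupp_itv (a := n - N%:Z - 1) (b := N%:Z)) => k h.
by apply: mode_nord_vanish NP _; lia.
Qed.

Lemma mode_quad_linear j n : linear (mode_quad j n).
Proof.
move=> a u v; rewrite /mode_quad.
have fZ : finsupp (fun k => a *: mode_nord j k (n - k - 1) u).
  by apply: (finsupp_map (h := fun=> *:%R a)) (mode_nord_finsupp _ _ _) => _;
    exact: scaler0.
rewrite -[X in _ = X + _]/(( *:%R a : {additive V -> V}) _).
rewrite fsum_additive; last exact: mode_nord_finsupp.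
rewrite -fsumD //; last exact: mode_nord_finsupp.
by apply: eq_fsbigr => k _; rewrite linearP.
Qed.
HB.instance Definition _ j n := GRing.isLinear.Build K V V _
  (mode_quad j n) (mode_quad_linear j n).

Lemma mode_sugawaraE n v : mode_sugawara n v =
  \sum_(j in I) (2 * l j)^-1 *: mode_quad j n v
  + ((n == 0)%:R * \sum_(j in I) frac j * (1 - frac j) / 4) *: v.
Proof.
rewrite /mode_sugawara; congr (_ + (_ * _) *: _); apply: eq_bigr => j _.
have /andP[j0 jp] := gap_index_bounds j.
have p0 : (p%:R : K) != 0 by rewrite pnatr_eq0; lia.
by rewrite natrM natrB ?(ltnW jp) //; field.
Qed.

Lemma mode_sugawara_linear n : linear (mode_sugawara n).
Proof.
move=> a u v; rewrite !mode_sugawaraE !(scalerDr _ (a *: u)) (scalerDr a).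
rewrite [RHS]addrACA; congr (_ + (_ + _)); last by rewrite !scalerA mulrC.
rewrite scaler_sumr -big_split /=; apply: eq_bigr => j _.
by rewrite linearP scalerDr !scalerA mulrC.
Qed.
HB.instance Definition _ n := GRing.isLinear.Build K V V _
  (mode_sugawara n) (mode_sugawara_linear n).

Lemma mode_sugawara_vanish v :
  exists2 N : nat, (0 < N)%N & forall n, N%:Z <= n -> mode_sugawara n v = 0.
Proof.
have [N N0 NP] := mode_vanish v; exists (2 * N)%N => [|n hn]; first by lia.
rewrite mode_sugawaraE (_ : (n == 0) = false); last by apply/eqP; lia.
rewrite mul0r scale0r addr0 big1 // => j _.
rewrite /mode_quad fsbig1 ?scaler0 // => k _.
by apply: mode_nord_vanish NP _; lia.
Qed.

Lemma modeZ i k a v : X i k (a *: v) = a *: X i k v.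
Proof. exact: linearZ. Qed.

(** The two summands come from the two factors: [X (gap_opp j)] fails to
    commute with [X i r] only if [j = i], and [X j] only if [j = gap_opp i].
    When [i = gap_opp i], both factors contribute. *)
Lemma mode_quad_comm_mode j i n r v : j \in I -> i \in I ->
  mode_quad j n (X i r v) = X i r (mode_quad j n v)
  - ((r%:~R + frac i) * ((j == i)%:R + (j == gap_opp i)%:R)) *:
      (l j *: X i (n + r) v).
Proof.
move=> jI iI; have ojI := I_sym jI.
(* [f k] is the contribution of the factor [X (gap_opp j) (n - k - 1)], and
   [g k] that of [X j k]; each is non-zero for at most one [k]. *)
pose f k := ((n%:~R - k%:~R - frac j)
  * ((j == i) && (k == n + r))%:R) *: (l j *: X j k v).
pose g k := ((k%:~R + frac j)
  * ((j == gap_opp i) && (k == - r - 1))%:R) *: (l j *: X (gap_opp j) (n - k - 1) v).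
have E k : mode_nord j k (n - k - 1) (X i r v)
    = X i r (mode_nord j k (n - k - 1) v) + (f k + g k).
  have e1 w : X (gap_opp j) (n - k - 1) (X i r w)
      = X i r (X (gap_opp j) (n - k - 1) w) + ((n%:~R - k%:~R - frac j)
          * ((j == i) && (k == n + r))%:R) *: (l j *: w).
    rewrite mode_comm // frac_opp gap_oppK level_opp // (eq_sym i); congr (_ + _ *: _).
    congr (_ * (_ && _)%:R); last by lia.
    by rewrite !rmorphB /=; ring.
  have e2 w : X j k (X i r w) = X i r (X j k w) + ((k%:~R + frac j)
          * ((j == gap_opp i) && (k == - r - 1))%:R) *: (l j *: w).
    rewrite mode_comm //; congr (_ + (_ * (_ && _)%:R) *: _); last by lia.
    by rewrite -(inj_eq (inv_inj (@gap_oppK p)) j) gap_oppK eq_sym.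
  rewrite /mode_nord; case: ifP => _.
    by rewrite e1 linearD e2 !modeZ (addrC (f k)) addrA.
  by rewrite e2 linearD e1 !modeZ addrA.
have f1 k : k != n + r -> f k = 0.
  by move=> /negPf h; rewrite /f h andbF mulr0 scale0r.
have g1 k : k != - r - 1 -> g k = 0.
  by move=> /negPf h; rewrite /g h andbF mulr0 scale0r.
rewrite /mode_quad; under eq_fsbigr do rewrite E.
have finf := finsupp1 f1; have fing := finsupp1 g1.
have finX : finsupp (fun k => X i r (mode_nord j k (n - k - 1) v)).
  by apply: (finsupp_map (h := fun=> X i r)) (mode_nord_finsupp _ _ _) => _;
    exact: linear0.
rewrite (fsumD finX (finsuppD finf fing)) (fsumD finf fing).
rewrite (fsum1 f1) (fsum1 g1) -fsum_additive; last exact: mode_nord_finsupp.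
congr (_ + _); rewrite /f /g !eqxx !andbT -scaleNr -mulNr mulrDr scalerDl.
congr (_ + _).
  have [->|] := eqVneq j i; last by rewrite !mulr0 !scale0r.
  by congr (_ *: _); rewrite !rmorphD /=; ring.
have [->|] := eqVneq j (gap_opp i); last by rewrite !mulr0 !scale0r.
rewrite gap_oppK frac_opp; congr (_ *: (_ *: X i _ v)); last by lia.
by rewrite !(rmorphB, rmorphN) /=; ring.
Qed.

Lemma levelV j : j \in I -> (2 * l j)^-1 * l j = 2^-1.
Proof. by move=> /l_generic lj; field. Qed.

(** The level cancels against [1 / (2 l_j)], and of the sum over [j] the terms
    [j = i] and [j = gap_opp i] survive, each with weight one half. *)
Lemma mode_sugawara_comm_mode i n r v : i \in I ->
  mode_sugawara n (X i r v)
  = X i r (mode_sugawara n v) - (r%:~R + frac i) *: X i (n + r) v.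
Proof.
move=> iI; rewrite !mode_sugawaraE linearD linearZ /= addrAC; congr (_ + _).
rewrite linear_sum /=.
under eq_bigr => j jI do rewrite mode_quad_comm_mode // scalerBr.
rewrite sumrB; congr (_ - _); first by apply: eq_bigr => j _; rewrite linearZ.
under eq_bigr => j jI.
  rewrite !scalerA [_^-1 * _ in X in X * _]mulrC -mulrA levelV // mulrAC.
  over.
rewrite -scaler_suml -mulr_sumr big_split /= -!natr_sum.
have sum1 i0 : i0 \in I -> (\sum_(j in I) (j == i0) = 1)%N.
  move=> i0I; rewrite (bigD1 i0) //= eqxx big1 // => j /andP[_].
  by move/negbTE->.
by rewrite !sum1 ?gap_opp_in // -(natrD _ 1 1) divfK ?pnatr_eq0.
Qed.

(** The scalar, in units of the level, between a product and its normally
    ordered form.  In degree [s = 0] the product [X_j(k) X_(p-j)(-k-1)] is out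
    of order exactly when [0 <= k]; in other degrees the factors commute. *)
Definition reorder_cst (j : gap_index p) (s k : int) : K :=
  (k%:~R + frac j) * ((s == 0) && (0 <= k))%:R.

Lemma mode_nordE j s k v : j \in I ->
  X j k (X (gap_opp j) (s - k - 1) v)
  = mode_nord j k (s - k - 1) v + reorder_cst j s k *: (l j *: v).
Proof.
move=> jI; rewrite /mode_nord /reorder_cst; case: ifP => h.
  rewrite (_ : _ && _ = false); last by lia.
  by rewrite mulr0 scale0r addr0.
rewrite mode_comm ?gap_opp_in // eqxx; congr (_ + (_ * _%:R) *: _).
by congr nat_of_bool; lia.
Qed.

(** The scalar left by the [k]-th product in the bracket of [L_m] with the
    quadratic sum of degree [n], once both products of degree [m + n] are put
    in normal order; the second one has first index [k + m]. *)
Definition cocycle_term (j : gap_index p) (m n k : int) : K :=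
  - (n%:~R - k%:~R - frac j) * reorder_cst j (m + n) k
  - (k%:~R + frac j) * reorder_cst j (m + n) (k + m).

(** For [n = - m] the two products come with opposite total scalars, so they
    cancel unless exactly one of them is out of order. *)
Lemma cocycle_term_eq0 j m n k :
  (0 <= k + m) = (0 <= k) -> cocycle_term j m n k = 0.
Proof.
rewrite /cocycle_term /reorder_cst; case: eqP => [s0|_] h; last first.
  by rewrite !mulr0 subr0.
rewrite h (_ : n = - m); last by lia.
by rewrite !(rmorphD, rmorphN) /=; ring.
Qed.

(** For [n != 0] the two factors of each product commute, so no case
    distinction on their order is needed; the bracket of [L_m] with [L_0] is
    later obtained from that of [L_0] with [L_m]. *)
Lemma mode_sugawara_comm_quad j m n v : j \in I -> n != 0 ->
  mode_sugawara m (mode_quad j n v) = mode_quad j n (mode_sugawara m v)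
  + ((m - n)%:~R *: mode_quad j (m + n) v
  + \sum_(k \in [set: int]%classic) cocycle_term j m n k *: (l j *: v)).
Proof.
move=> jI n0; set w := l j *: v; have ojI := I_sym jI.
have plain u k : mode_nord j k (n - k - 1) u = X j k (X (gap_opp j) (n - k - 1) u).
  by rewrite mode_nordE // /reorder_cst (negbTE n0) mulr0 scale0r addr0.
(* [f] and [g] collect the brackets of [L_m] with the second and with the
   first factor; [g] is indexed by the first index of the new product. *)
pose N k := mode_nord j k (m + n - k - 1) v.
pose f k := (- (n%:~R - k%:~R - frac j)) *: N k.
pose g k := (- (k%:~R - m%:~R + frac j)) *: N k.
have finN : finsupp N by exact: mode_nord_finsupp.
have finf : finsupp f.
  by apply: (finsupp_map (h := fun k : int => *:%R _)) finN => k; exact: scaler0.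
have fing : finsupp g.
  by apply: (finsupp_map (h := fun k : int => *:%R _)) finN => k; exact: scaler0.
have finc : finsupp (fun k => cocycle_term j m n k *: w).
  apply: (finsupp_itv (a := - `|m|) (b := `|m|)) => k hk.
  by rewrite cocycle_term_eq0 ?scale0r //; lia.
have E k : mode_sugawara m (mode_nord j k (n - k - 1) v)
  = mode_nord j k (n - k - 1) (mode_sugawara m v)
    + (f k + g (k + m) + cocycle_term j m n k *: w).
  rewrite !plain mode_sugawara_comm_mode // mode_sugawara_comm_mode // linearB modeZ.
  rewrite -[LHS]addrA; congr (_ + _).
  have -> : m + (n - k - 1) = m + n - k - 1 by lia.
  have {2}-> : n - k - 1 = m + n - (m + k) - 1 by lia.
  rewrite !mode_nordE // -/w (addrC m k) /f /g /cocycle_term frac_opp.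
  rewrite -/(N k) -/(N (k + m)) -!scaleNr !scalerDr !scalerA addrACA -scalerDl.
  by congr (_ *: _ + _ *: _ + _ *: _); rewrite !(rmorphB, rmorphD) /=; ring.
rewrite {1}/mode_quad fsum_additive /=; last exact: mode_nord_finsupp.
under eq_fsbigr do rewrite E.
have finL : finsupp (fun k => mode_nord j k (n - k - 1) (mode_sugawara m v)).
  exact: mode_nord_finsupp.
have fing' := finsupp_shift m fing.
have finfg := finsuppD finf fing'.
rewrite (fsumD finL (finsuppD finfg finc)) (fsumD finfg finc) (fsumD finf fing').
congr (_ + (_ + _)).
(* After the shift both sums run over the same products, and the coefficients
   add up to [m - n], which no longer depends on [k]. *)
transitivity (\sum_(k \in [set: int]%classic) (f k + g k)).
  rewrite (fsumD finf fing); congr (_ + _); exact: fsum_shift.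
transitivity (( *:%R (m - n)%:~R : {additive V -> V}) (mode_quad j (m + n) v)) => //.
rewrite fsum_additive //; apply: eq_fsbigr => k _; rewrite /f /g -scalerDl /=.
by congr (_ *: _); rewrite rmorphB /=; ring.
Qed.

(** Keeping [x] independent of [t] is what makes induction on [t] work; the
    case of interest is [x = t]. *)
Lemma sum_cocycle_poly (t : nat) (x a : K) :
  \sum_(i < t) (x + a - i.+1%:R) * (a - i.+1%:R)
  = t%:R * (x + a) * a - (x + 2 * a) * (t%:R * (t%:R + 1)) / 2
    + t%:R * (t%:R + 1) * (2 * t%:R + 1) / 6.
Proof.
elim: t => [|t IH]; first by rewrite big_ord0; field.
by rewrite big_ord_recr /= IH -natr1; field.
Qed.

(** The only [k] for which exactly one of [k] and [k + m] is negative are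
    [- m <= k < 0]; taking [0 < m] fixes on which side of [0] they lie. *)
Lemma sum_cocycle j m n v : (m + n = 0 -> 0 < m) ->
  \sum_(k \in [set: int]%classic) cocycle_term j m n k *: v
  = ((m + n == 0)%:R
     * ((m ^+ 3 - m)%:~R / 6 + m%:~R * frac j * (1 - frac j))) *: (v : V).
Proof.
move=> h; case: eqP => [s0|s0]; last first.
  rewrite mul0r scale0r fsbig1 // => k _.
  by rewrite /cocycle_term /reorder_cst (introF eqP s0) !mulr0 subr0 scale0r.
have m0 := h s0; have [t mt] : exists t : nat, m = t by exists `|m|%N; lia.
subst m; have -> : n = - t%:Z by lia.
rewrite (@fsum_neg_window _ _ t) => [|k hk]; last first.
  by rewrite cocycle_term_eq0 ?scale0r //; lia.
rewrite -scaler_suml mul1r; congr (_ *: _).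
transitivity (- \sum_(i < t) (t%:R + frac j - i.+1%:R) * (frac j - i.+1%:R)).
  rewrite -sumrN; apply: eq_bigr => i _; rewrite /cocycle_term /reorder_cst subrr eqxx /=.
  rewrite (_ : (0 <= - i.+1%:Z + t) = true); last by have := ltn_ord i; lia.
  rewrite mulr0 mulr0 sub0r mulr1 !(rmorphD, rmorphN) /= -!pmulrn.
  ring.
set a := frac j; rewrite sum_cocycle_poly !(rmorphB, rmorphXn) /= -!pmulrn.
by field.
Qed.

(** Half of [m a (1 - a)], summed over [j], is [2 m] times the constant of
    [L_0]: it turns the quadratic sums of degree [0] into [L_0] itself. *)
Lemma mode_sugawara_comm m n v : n != 0 -> (m + n = 0 -> 0 < m) ->
  mode_sugawara m (mode_sugawara n v) = mode_sugawara n (mode_sugawara m v)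
  + ((m - n)%:~R *: mode_sugawara (m + n) v
     + ((m ^+ 3 - m)%:~R / 12 * (m + n == 0)%:R) *: (#|I|%:R *: v)).
Proof.
move=> n0 h; have sug0 u :
    mode_sugawara n u = \sum_(j in I) (2 * l j)^-1 *: mode_quad j n u.
  by rewrite mode_sugawaraE (negbTE n0) mul0r scale0r addr0.
rewrite !sug0 linear_sum /=.
under eq_bigr => j jI.
  rewrite linearZ /= mode_sugawara_comm_quad // sum_cocycle // !scalerDr.
  rewrite [X in _ + (_ + X)]scalerA [X in _ + (_ + X)]scalerA mulrAC levelV //.
  over.
rewrite !big_split /=; congr (_ + _).
rewrite mode_sugawaraE scalerDr -addrA; congr (_ + _).
  by rewrite scaler_sumr; apply: eq_bigr => j _; rewrite !scalerA mulrC.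
rewrite -scaler_suml !scalerA -scalerDl; congr (_ *: _).
rewrite -sum1_card natr_sum !mulr_sumr -big_split /=; apply: eq_bigr => j _.
case: eqP => [s0|_]; last by rewrite !(mul0r, mulr0, addr0).
have -> : n = - m by lia.
by move: (frac j) => a; rewrite !(rmorphB, rmorphN, rmorphXn) /=; field.
Qed.

(** [C_i] and [C_(p-i)] are the same basis element, so its scalar has to be read
    off from one of the two indices; [level_opp] makes the choice immaterial
    on vectors. *)
Definition mode_cen (k : 'I_(p./2).+1) : K :=
  if k == ord0 then #|I|%:R
  else if [pick i in I | gap_cen i == k] is Some i then l i else 0.

Lemma mode_cenE i (v : V) :
  mode_cen (gap_cen i) *: v = if i \in I then l i *: v else 0.
Proof.
rewrite /mode_cen gap_cen_neq0; case: pickP => [j /andP[jI /eqP/gap_cen_eq[->|->]]|].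
- by rewrite jI.
- by rewrite gap_opp_in jI level_opp.
- by move=> /(_ i); rewrite eqxx andbT => ->; rewrite scale0r.
Qed.

Definition mode_act (b : gap_basis p) (v : V) : V :=
  match b with
  | GapL n => mode_sugawara n v
  | GapI n i => X i n v
  | GapC k => mode_cen k *: v
  end.

Lemma mode_act_linear b : linear (mode_act b).
Proof.
by case: b => [n|n i|k] a u v /=; rewrite ?linearP // scalerDr !scalerA mulrC.
Qed.
HB.instance Definition _ b := GRing.isLinear.Build K V V _
  (mode_act b) (mode_act_linear b).

Let respects b c := forall v,
  gap_br (mode_act^~ v) b c = mode_act b (mode_act c v) - mode_act c (mode_act b v).

Lemma respects_sym b c : respects b c -> respects c b.
Proof. by move=> bc v; rewrite gap_brC bc opprB. Qed.

(** Antisymmetry reduces to the pairs treated by [mode_sugawara_comm]: unless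
    [m = n = 0], one of [(m, n)] and [(n, m)] has non-zero second entry, and,
    if [m + n = 0], positive first entry. *)
Lemma mode_act_LL m n : respects (GapL m) (GapL n).
Proof.
wlog h : m n / n != 0 /\ (m + n = 0 -> 0 < m) => [wl|].
  have [|] := boolP ((m == 0) && (n == 0)) => [/andP[/eqP-> /eqP->] v /=|mn].
    by rewrite !(subrr, expr0n, mul0r, scale0r, addr0, mulr0n).
  have [h|h] : (n != 0 /\ (m + n = 0 -> 0 < m)) \/ (m != 0 /\ (n + m = 0 -> 0 < n)).
    by lia.
  - exact: wl.
  - by apply: respects_sym; exact: wl.
case: h => n0 m0 v /=; rewrite mode_sugawara_comm // addrAC subrr add0r.
by rewrite /mode_cen eqxx.
Qed.

Lemma mode_act_LI m n i : respects (GapL m) (GapI n i).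
Proof.
move=> v /=; have [iI|iI] := boolP (i \in I).
  by rewrite mode_sugawara_comm_mode // addrAC subrr add0r scaleNr.
by rewrite !(mode_out _ _ iI) !linear0 addr0.
Qed.

(** If only one of [i], [j] is in [I], then [j != gap_opp i], as [I] is
    symmetrical: the bracket vanishes, like the action. *)
Lemma mode_act_II m n i j : respects (GapI m i) (GapI n j).
Proof.
move=> v /=; rewrite mode_cenE gap_add_eqp; have [iI|iI] := boolP (i \in I).
  have [jI|jI] := boolP (j \in I).
    by rewrite mode_comm // [X in _ = X - _]addrC addrK.
  rewrite !(mode_out _ _ jI) !linear0 addr0 (_ : (j == gap_opp i) = false).
    by rewrite mulr0 scale0r.
  by apply/negbTE; apply: contra jI => /eqP ->; exact: I_sym.
by rewrite !(mode_out _ _ iI) !linear0 addr0.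
Qed.

Lemma mode_act_br b c : respects b c.
Proof.
have brC k d : respects (GapC k) d.
  by move=> v /=; rewrite linearZ subrr.
case: b c => [m|m i|k] [n|n j|k'] //.
- exact: mode_act_LL.
- exact: mode_act_LI.
- by apply: respects_sym.
- by apply: respects_sym; exact: mode_act_LI.
- exact: mode_act_II.
- by apply: respects_sym.
Qed.

End Modes.

(** * Modules given on the basis *)

Lemma gap_br_map (K : numFieldType) p (W W' : lmodType K) (f : W -> W')
    (e : gap_basis p -> W) b c :
  linear f -> f (gap_br e b c) = gap_br (fun d => f (e d)) b c.
Proof.
move=> fl; have f0 : f 0 = 0.
  by have := fl (-1) 0 0; rewrite !scaleN1r !addNr.
have fZ a x : f (a *: x) = a *: f x by have := fl a x 0; rewrite f0 !addr0.
by case: b c => [m|m i|k] [n|n j|k'] //=; rewrite ?fl ?fZ.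
Qed.

Section BasisModule.
Context (K : numFieldType) (p : nat) (V : lmodType K).
Context (act : gap_basis p -> V -> V).
Hypotheses (act_linear : forall b, linear (act b)) (act_br : forall b c v,
  gap_br (act^~ v) b c = act b (act c v) - act c (act b v)).

Definition gap_rep (x : gapVir K p) (v : V) : V := malg_lin (act^~ v) x.

Lemma gap_rep_linearl v : linear (fun x => gap_rep x v).
Proof. exact: malg_linP. Qed.

Lemma gap_rep_linearr x : linear (gap_rep x).
Proof.
move=> a u v; rewrite /gap_rep /malg_lin scaler_sumr -big_split /=.
by apply: eq_bigr => b _; rewrite act_linear scalerDr !scalerA mulrC.
Qed.
HB.instance Definition _ x := GRing.isLinear.Build K V V _
  (gap_rep x) (gap_rep_linearr x).

Lemma gap_repU b v : gap_rep << b >> v = act b v.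
Proof. exact: malg_linU. Qed.

Lemma gap_rep_lie x y v :
  gap_rep (lie x y) v = gap_rep x (gap_rep y v) - gap_rep y (gap_rep x v).
Proof.
apply/eqP; rewrite -subr_eq0; apply/eqP.
pose D x y := gap_rep (lie x y) v
  - (gap_rep x (gap_rep y v) - gap_rep y (gap_rep x v)).
have repl a t u w : gap_rep (a *: t + u) w = a *: gap_rep t w + gap_rep u w.
  exact: gap_rep_linearl.
have subl a (w w' z z' : V) :
    a *: w + w' - (a *: z + z') = a *: (w - z) + (w' - z').
  by rewrite opprD addrACA scalerBr.
have Dl u : linear (fun t => D t u).
  by move=> a s t; rewrite /D lie_linearl !repl linearP !subl.
have Dr t : linear (D t).
  by move=> a s u; rewrite /D lie_linearr !repl linearP !subl.
rewrite -/(D x y); apply: (malg_lin_eq0 (Dl y)) => b.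
apply: (malg_lin_eq0 (Dr << b >>)) => c; rewrite /D !gap_repU -act_br.
rewrite [lie _ _]gap_lieUU (gap_br_map _ _ _ (gap_rep_linearl v)) /=.
by under eq_fun do rewrite gap_repU; rewrite subrr.
Qed.

Definition gap_module : lieModule (gapVir K p) V :=
  LieModule gap_rep_linearl gap_rep_linearr gap_rep_lie.

End BasisModule.

(** * The modes of a restricted module of given level *)

Section HeisenbergModes.
Context (K : numFieldType) (p : nat) (I : {set gap_index p}) (V : lmodType K).
Context (rho : lieModule (heis K I) V) (l : gap_index p -> K).
Hypotheses (I_sym : symmetrical I)
  (rho_restricted : restricted (@heis_hom K p I) rho)
  (rho_level : has_level rho l).

Local Notation X i n := (lact rho (heisI n i)).
Local Notation frac i := ((gap_val i)%:R / p%:R : K).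

Lemma heis_mode_out i n v : i \notin I -> X i n v = 0.
Proof. by move=> iI; rewrite heisI_out // lact0. Qed.

Lemma heis_level_opp i (v : V) : i \in I -> l (gap_opp i) *: v = l i *: v.
Proof.
move=> iI; have := rho_level (I_sym iI) v; rewrite heisC_opp => <-.
by rewrite rho_level.
Qed.

Lemma heis_mode_comm i j m n (v : V) : i \in I -> j \in I ->
  X i m (X j n v) = X j n (X i m v)
  + ((m%:~R + frac i) * ((j == gap_opp i) && (m + n + 1 == 0))%:R) *: (l i *: v).
Proof.
move=> iI jI; apply/eqP; rewrite addrC -subr_eq -lact_lie -(rho_level iI) -lactZ.
apply/eqP; congr (rho _ v); apply/val_inj.
have -> (c : K) (x : heis K I) : val (c *: x) = c *: val x by [].
rewrite val_heisC // -gap_add_eqp.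
have -> (x y : heis K I) : val (lie x y) = gap_lie (val x) (val y) by [].
apply: etrans (congr2 _ (val_heisI K m iI) (val_heisI K n jI)) _.
exact: gap_lieUU.
Qed.

Lemma heis_mode_vanish v :
  exists2 N : nat, (0 < N)%N & forall i n, N%:Z <= n -> X i n v = 0.
Proof.
have [N N0 NP] := rho_restricted v; exists N => // i n /NP; apply.
rewrite /heis_hom /gap_hom; have [iI|/heisI_out ->] := boolP (i \in I).
  rewrite val_heisI //; apply/allP => b /(fsubsetP msuppU_le) /fset1P -> /=.
  exact: eqxx.
exact: rpred0.
Qed.

End HeisenbergModes.

(** * The module over the gap Virasoro algebra *)

Theorem proposition3p1 (R : realType) (p : nat) (p_gt1 : (1 < p)%N)
    (I : {set gap_index p}) (I_neq0 : I != finset.set0)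
    (I_sym : symmetrical I) (V : lmodType R[i])
    (rho : lieModule (heis R[i] I) V) (l : gap_index p -> R[i])
    (rho_restricted : restricted (@heis_hom R[i] p I) rho)
    (rho_level : has_level rho l) (l_generic : generic_level I l) :
  (forall (n : int) (j : gap_index p), j \in I ->
     locally_finite (fun k => normal_ord rho j k (n - k - 1))) /\
  exists sigma : lieModule (gapVir R[i] p) V,
    [/\ restricted (@gap_hom R[i] p) sigma,
        forall (n : int) (i : gap_index p) v,
          sigma (gapI n i) v = if i \in I then rho (heisI n i) v else 0,
        forall (i : gap_index p) v,
          sigma (gapC (gap_cen i)) v = if i \in I then l i *: v else 0,
        forall v, sigma (gapC ord0) v = #|I|%:R *: v &
        forall (n : int) v, sigma (gapL n) v = sugawara rho l n v].
Proof.
pose X i n : {linear V -> V} := lact rho (heisI n i).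
have out := heis_mode_out rho.
have comm := heis_mode_comm rho_level.
have van := heis_mode_vanish rho_restricted.
have lopp := heis_level_opp I_sym rho_level.
have br := @mode_act_br R[i] p I V X l I_sym l_generic lopp out comm van.
have lin := @mode_act_linear R[i] p I V X l van.
split=> [n j jI v|]; first exact: (mode_nord_finsupp (X := X) van).
exists (gap_module lin br); split.
- move=> v; have [N N0 NP] := van v.
  have [M M0 MP] := mode_sugawara_vanish (X := X) I l van v.
  exists (maxn N M) => [|n hn x hx]; first by lia.
  rewrite /= /gap_rep /malg_lin big_seq big1 // => b bx.
  have /eqP degb := allP hx b bx.
  case: b degb bx => [m|m i|k] /= degb _.
  + by rewrite MP ?scaler0 //; lia.
  + by rewrite NP ?scaler0 //; lia.
  + by lia.
- move=> n i v; rewrite /= gap_repU /=; case: ifP => // /negbT.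
  exact: out.
- move=> i v; rewrite /= gap_repU /=; exact: mode_cenE.
- by move=> v; rewrite /= gap_repU /= /mode_cen eqxx.
- by move=> n v; rewrite /= gap_repU.
Qed.
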